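(* Suppose $\lambda_1=0$ and $\beta$ satisfies condition $(E)$. Let $\varphi$ be an entire function and $C_\varphi f=f\circ\varphi$. Then $C_\varphi$ is a bounded operator from $\mathcal{H}(E,\beta)$ into itself if and only if either (i) $\varphi$ is constant, or (ii) $\varphi(z)=z+b$ for some $b\in\mathbb{C}$ with $\operatorname{Re}(b)\ge0$. Moreover, $\|C_\varphi\|\ge1$ in case (i), and $\|C_\varphi\|=1$ in case (ii).
   Context: Fix a sequence $\Lambda=(\lambda_n)_{n\ge1}$ of real numbers with $0\le\lambda_1<\lambda_2<\cdots$ and $\lambda_n\to+\infty$, such that $\limsup_{n\to\infty}\frac{\log n}{\lambda_n}<+\infty$. For a sequence $\beta=(\beta_n)$ of positive reals, condition $(E)$ is: $\liminf_{n\to\infty}\frac{\log\beta_n}{\lambda_n}=+\infty$. Under $(E)$, $\mathcal{H}(E,\beta)$ denotes the Hilbert space of entire functions $f(z)=\sum_{n=1}^\infty a_ne^{-\lambda_nz}$ ($a_n\in\mathbb{C}$; the representation is unique) with norm $\|f\|=\big(\sum_{n=1}^\infty|a_n|^2\beta_n^2\big)^{1/2}<\infty$. When $\lambda_1=0$ this space contains the constant functions. *)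

(* Defs.v *)
From Stdlib Require Import Reals Lra.
Open Scope R_scope.

Definition Cplx := (R * R)%type.
Definition Re (z : Cplx) : R := fst z.
Definition Im (z : Cplx) : R := snd z.
Definition Cadd (z w : Cplx) : Cplx := (Re z + Re w, Im z + Im w).
Definition Csub (z w : Cplx) : Cplx := (Re z - Re w, Im z - Im w).
Definition Cmul (z w : Cplx) : Cplx :=
  (Re z * Re w - Im z * Im w, Re z * Im w + Im z * Re w).
Definition Cnorm2 (z : Cplx) : R := Re z * Re z + Im z * Im z.
Definition Cnorm (z : Cplx) : R := sqrt (Cnorm2 z).

Definition Cexp_neg (l : R) (z : Cplx) : Cplx :=
  (exp (- l * Re z) * cos (l * Im z), - (exp (- l * Re z) * sin (l * Im z))).

Definition entire (phi : Cplx -> Cplx) : Prop :=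
  forall z : Cplx, exists l : Cplx, forall eps : R, 0 < eps -> exists delta : R, 0 < delta /\
    forall h : Cplx, Cnorm h < delta ->
      Cnorm (Csub (Csub (phi (Cadd z h)) (phi z)) (Cmul l h)) <= eps * Cnorm h.

(* Standing hypotheses on Lambda = (lambda_n)_{n>=1}; lam k stands for lambda_{k+1}. *)
Definition frequencies (lam : nat -> R) : Prop :=
  0 <= lam 0%nat /\
  (forall n, lam n < lam (S n)) /\
  cv_infty lam /\
  (* limsup log n / lambda_n < +infinity *)
  (exists M : R, exists N0 : nat, forall n, (N0 <= n)%nat ->
      ln (INR (S n)) / lam n <= M).

(* condition (E): liminf log beta_n / lambda_n = +infinity *)
Definition condE (lam beta : nat -> R) : Prop :=
  (forall n, 0 < beta n) /\
  forall M : R, exists N0 : nat, forall n, (N0 <= n)%nat -> M <= ln (beta n) / lam n.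

Fixpoint dpartial (lam : nat -> R) (a : nat -> Cplx) (z : Cplx) (N : nat) : Cplx :=
  match N with
  | O => Cmul (a O) (Cexp_neg (lam O) z)
  | S k => Cadd (dpartial lam a z k) (Cmul (a (S k)) (Cexp_neg (lam (S k)) z))
  end.

Definition dirichlet_rep (lam : nat -> R) (f : Cplx -> Cplx) (a : nat -> Cplx) : Prop :=
  forall z : Cplx,
    Un_cv (fun N => Re (dpartial lam a z N)) (Re (f z)) /\
    Un_cv (fun N => Im (dpartial lam a z N)) (Im (f z)).

(* sum_n |a_n|^2 beta_n^2 = s  (so the H(E,beta)-norm is sqrt s) *)
Definition coef_normsq (beta : nat -> R) (a : nat -> Cplx) (s : R) : Prop :=
  infinite_sum (fun n => Cnorm2 (a n) * (beta n) ^ 2) s.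

Definition inH (lam beta : nat -> R) (f : Cplx -> Cplx) : Prop :=
  exists a s, dirichlet_rep lam f a /\ coef_normsq beta a s.

Definition comp_bounded (lam beta : nat -> R) (phi : Cplx -> Cplx) : Prop :=
  (forall f, inH lam beta f -> inH lam beta (fun z => f (phi z))) /\
  exists K : R, forall f a s b t,
    dirichlet_rep lam f a -> coef_normsq beta a s ->
    dirichlet_rep lam (fun z => f (phi z)) b -> coef_normsq beta b t ->
    sqrt t <= K * sqrt s.

(* the set { ||C_phi f|| / ||f|| : f in H, f <> 0 }; its lub is ||C_phi|| *)
Definition comp_ratios (lam beta : nat -> R) (phi : Cplx -> Cplx) (r : R) : Prop :=
  exists f a s b t,
    dirichlet_rep lam f a /\ coef_normsq beta a s /\ 0 < s /\
    dirichlet_rep lam (fun z => f (phi z)) b /\ coef_normsq beta b t /\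
    r = sqrt t / sqrt s.

Definition is_constant (phi : Cplx -> Cplx) : Prop := exists c : Cplx, forall z, phi z = c.

Definition is_translation (phi : Cplx -> Cplx) : Prop :=
  exists b : Cplx, 0 <= Re b /\ forall z, phi z = Cadd z b.

(* Main.v *)
(* The kernel at w has squared norm W(Re w), where W(x) = sum_n e^(-2 lam_n x) / beta_n^2.
   If C_phi is bounded by K, testing it on (truncated) kernels gives
   W(Re (phi w)) <= K^2 W(Re w), and comparing the two series yields Re (phi w) >= Re w - D
   as soon as Re w is negative enough. Hence g = e^(-lam_1 phi), which is in the space, is
   O(e^(-lam_1 Re z)) as Re z -> -oo. A Dirichlet series satisfies
   |b_n| e^(-lam_n x) <= sup_y |g(x + iy)|, so only the frequencies 0 and lam_1 survive:
   g = b_0 + b_1 e^(-lam_1 z). Being an exponential, g has no zero, so b_0 = 0 or b_1 = 0,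
   and phi is a translation or a constant by continuity; testing on e^(-lam_k z) for large k
   gives Re b >= 0. The coefficient estimate also yields the uniqueness of coefficients,
   on which the norm computations in both cases rest. *)

From Stdlib Require Import Reals Lra Lia Arith.
From Coquelicot Require Import Coquelicot.
Require Import Defs.
Open Scope R_scope.

(** * Modulus and elementary properties of the complex exponentials *)

Lemma exp_le x y : x <= y -> exp x <= exp y.
Proof. intros [H| ->]; [ left; now apply exp_increasing | lra ]. Qed.

Lemma Cnorm_Cmod (z : C) : Cnorm z = Cmod z.
Proof. unfold Cnorm, Cnorm2, Cmod, Re, Im. f_equal. ring. Qed.

Lemma Cnorm2_Cmod (z : C) : Cnorm2 z = Cmod z ^ 2.
Proof.
  rewrite <- Cnorm_Cmod. unfold Cnorm. simpl. rewrite Rmult_1_r, sqrt_sqrt; [ easy | ].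
  unfold Cnorm2. nra.
Qed.

Lemma Cmod_Cexp_neg (l : R) (z : C) : Cmod (Cexp_neg l z) = exp (- l * Re z).
Proof.
  unfold Cmod, Cexp_neg. simpl fst. simpl snd.
  replace (_ ^ 2 + _ ^ 2)
    with (exp (- l * Re z) ^ 2 * (Rsqr (sin (l * Im z)) + Rsqr (cos (l * Im z))))
    by (unfold Rsqr; ring).
  rewrite sin2_cos2, Rmult_1_r.
  apply sqrt_pow2. left; apply exp_pos.
Qed.

Lemma Cexp_neg_add (l : R) (z w : C) :
  Cexp_neg l (Cplus z w) = Cmult (Cexp_neg l z) (Cexp_neg l w).
Proof.
  unfold Cexp_neg, Cmult, Cplus, Re, Im; simpl.
  rewrite !Rmult_plus_distr_l, exp_plus, cos_plus, sin_plus.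
  f_equal; ring.
Qed.

Lemma Cexp_neg_freq_0 (z : C) : Cexp_neg 0 z = RtoC 1.
Proof.
  unfold Cexp_neg. rewrite Ropp_0, !Rmult_0_l, exp_0, cos_0, sin_0.
  unfold RtoC. f_equal; ring.
Qed.

Lemma Cexp_neg_nonzero (l : R) (z : C) : Cexp_neg l z <> RtoC 0.
Proof.
  intros H. generalize (exp_pos (- l * Re z)).
  rewrite <- Cmod_Cexp_neg, H, Cmod_0. lra.
Qed.

Lemma Im_le_Cmod (z : C) : Rabs (Im z) <= Cmod z.
Proof. eapply Rle_trans; [ apply Rmax_r | apply (Rmax_Cmod z) ]. Qed.

Lemma Cmod_le_Re_Im (z : C) : Cmod z <= Rabs (Re z) + Rabs (Im z).
Proof.
  destruct z as [x y]. unfold Cmod, Re, Im; simpl fst; simpl snd.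
  apply Rsqr_incr_0_var.
  - rewrite Rsqr_sqrt by (generalize (pow2_ge_0 x) (pow2_ge_0 y); lra).
    unfold Rsqr. rewrite <- (pow2_abs x), <- (pow2_abs y).
    generalize (Rabs_pos x) (Rabs_pos y). nra.
  - generalize (Rabs_pos x) (Rabs_pos y). lra.
Qed.

(* [ring] is registered for the carrier [C], not for its synonym [Cplx]. *)
Ltac Cring := match goal with |- @eq _ ?x ?y => change (@eq C x y); ring end.

(** * Finite complex sums *)

(** Starting from the empty sum lets inductions begin at 0. The price is a shift of index:
    [dpartial] up to [N] is [csum] at [S N]. *)
Fixpoint csum (u : nat -> C) (n : nat) : C :=
  match n with
  | O => RtoC 0
  | S k => Cplus (csum u k) (u k)
  end.

Lemma csum_ext (u v : nat -> C) n :
  (forall k, (k < n)%nat -> u k = v k) -> csum u n = csum v n.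
Proof.
  induction n as [|n IH]; intros H; simpl; [ easy | ].
  rewrite IH, H; auto.
Qed.

Lemma csum_0 n : csum (fun _ => RtoC 0) n = RtoC 0.
Proof. induction n as [|n IH]; simpl; [ | rewrite IH ]; ring. Qed.

Lemma csum_plus (u v : nat -> C) n :
  csum (fun k => Cplus (u k) (v k)) n = Cplus (csum u n) (csum v n).
Proof. induction n as [|n IH]; simpl; [ | rewrite IH ]; ring. Qed.

Lemma csum_scal (c : C) (u : nat -> C) n :
  csum (fun k => Cmult c (u k)) n = Cmult c (csum u n).
Proof. induction n as [|n IH]; simpl; [ | rewrite IH ]; ring. Qed.

Lemma csum_RtoC (u : nat -> R) N :
  csum (fun k => RtoC (u k)) (S N) = RtoC (sum_f_R0 u N).
Proof.
  induction N as [|N IH].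
  - simpl. rewrite <- RtoC_plus. f_equal. ring.
  - change (csum (fun k => RtoC (u k)) (S (S N)))
      with (Cplus (csum (fun k => RtoC (u k)) (S N)) (RtoC (u (S N)))).
    rewrite IH, <- RtoC_plus. easy.
Qed.

Lemma Cmod_csum_le (u : nat -> C) N :
  Cmod (csum u (S N)) <= sum_f_R0 (fun n => Cmod (u n)) N.
Proof.
  induction N as [|N IH].
  - simpl. rewrite Cplus_0_l. lra.
  - eapply Rle_trans; [ apply Cmod_triangle | ].
    rewrite tech5. apply Rplus_le_compat_r, IH.
Qed.

Lemma Cmod_csum_sub_le (u : nat -> C) N k :
  Cmod (Cminus (csum u (S (N + k))) (csum u (S N)))
  <= sum_f_R0 (fun n => Cmod (u n)) (N + k) - sum_f_R0 (fun n => Cmod (u n)) N.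
Proof.
  induction k as [|k IH].
  - rewrite Nat.add_0_r.
    replace (Cminus _ _) with (RtoC 0) by ring. rewrite Cmod_0. lra.
  - rewrite Nat.add_succ_r, tech5.
    change (csum u (S (S (N + k)))) with (Cplus (csum u (S (N + k))) (u (S (N + k)))).
    replace (Cminus _ _)
      with (Cplus (Cminus (csum u (S (N + k))) (csum u (S N))) (u (S (N + k)))) by ring.
    eapply Rle_trans; [ apply Cmod_triangle | ]. lra.
Qed.

(** * Bounding a coefficient by the supremum over a vertical line *)

Definition dterm (lam : nat -> R) (a : nat -> Cplx) (z : Cplx) (n : nat) : C :=
  Cmult (a n) (Cexp_neg (lam n) z).

Lemma dpartial_csum lam a z N : dpartial lam a z N = csum (dterm lam a z) (S N).
Proof.
  induction N as [|N IH].
  - simpl. rewrite Cplus_0_l. easy.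
  - simpl dpartial. rewrite IH. easy.
Qed.

Lemma Cmod_dterm lam a z n :
  Cmod (dterm lam a z n) = Cmod (a n) * exp (- lam n * Re z).
Proof. unfold dterm. now rewrite Cmod_mult, Cmod_Cexp_neg. Qed.

(* Averaging the sum with its translate by i*pi/(lam_N - l), rotated so as to leave the
   l-term fixed, cancels the lam_N-term and keeps the bound B. *)
Lemma coef_bound_finite (lam : nat -> R) (l x B : R) (c : C) N :
  forall d : nat -> C,
  (forall j, (j < N)%nat -> d j = RtoC 0 \/ lam j <> l) ->
  (forall y, Cmod (Cplus (Cmult c (Cexp_neg l (x, y)))
                         (csum (dterm lam d (x, y)) N)) <= B) ->
  Cmod c * exp (- l * x) <= B.
Proof.
  induction N as [|N IH]; intros d Hd HB.
  - specialize (HB 0). simpl in HB.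
    rewrite Cplus_0_r, Cmod_mult, Cmod_Cexp_neg in HB. exact HB.
  - destruct (Hd N) as [H0|Hne]; [ lia | | ].
    + apply (IH d); [ intros; apply Hd; lia | ].
      intros y. specialize (HB y). simpl in HB.
      unfold dterm at 2 in HB. rewrite H0, Cmult_0_l, Cplus_0_r in HB. exact HB.
    + set (h := PI / (lam N - l)).
      set (kappa := Cexp_neg (- l) (0, h)).
      set (half := RtoC (1 / 2)).
      set (rho := fun m => Cmult half (Cplus (RtoC 1) (Cmult kappa (Cexp_neg m (0, h))))).
      set (d' := fun j => Cmult (d j) (rho (lam j))).
      assert (Hk : Cmod kappa = 1).
      { unfold kappa. rewrite Cmod_Cexp_neg. unfold Re; simpl. rewrite Rmult_0_r. apply exp_0. }
      assert (Hhalf : Cmod half = 1 / 2).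
      { unfold half. rewrite Cmod_R. apply Rabs_pos_eq. lra. }
      assert (Hkm : forall m, Cmult kappa (Cexp_neg m (0, h)) = Cexp_neg (m - l) (0, h)).
      { intros m. unfold kappa, Cexp_neg, Cmult, Re, Im; simpl.
        rewrite !Rmult_0_r, !exp_0.
        replace ((m - l) * h) with (m * h + (- l) * h) by ring.
        rewrite cos_plus, sin_plus. f_equal; ring. }
      assert (Hrl : rho l = RtoC 1).
      { unfold rho. rewrite Hkm. unfold Rminus. rewrite Rplus_opp_r, Cexp_neg_freq_0.
        unfold half. rewrite <- RtoC_plus, <- RtoC_mult. f_equal. field. }
      assert (HrN : rho (lam N) = RtoC 0).
      { unfold rho. rewrite Hkm. unfold Cexp_neg, Re, Im; simpl.
        replace ((lam N - l) * h) with PI by (unfold h; field; lra).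
        rewrite cos_PI, sin_PI, !Rmult_0_r, exp_0.
        unfold half, RtoC, Cmult, Cplus; simpl. f_equal; field. }
      assert (Hshift : forall m y, Cmult (rho m) (Cexp_neg m (x, y))
        = Cmult half (Cplus (Cexp_neg m (x, y)) (Cmult kappa (Cexp_neg m (x, y + h))))).
      { intros m y.
        replace ((x, y + h) : C) with (Cplus (x, y) (0, h))
          by (unfold Cplus; simpl; f_equal; ring).
        rewrite Cexp_neg_add. unfold rho. ring. }
      apply (IH d').
      * intros j Hj. destruct (Hd j) as [E|E]; [ lia | left | now right ].
        unfold d'. rewrite E. ring.
      * intros y.
        (* Since [rho (lam N)] vanishes, the term of index [N] may be put back, which gives the sums
           over [S N] terms that [HB] controls. *)
        assert (HN : csum (dterm lam d' (x, y)) N = csum (dterm lam d' (x, y)) (S N)).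
        { simpl. unfold dterm at 3, d'. rewrite HrN. ring. }
        rewrite HN.
        replace (Cplus _ _) with
          (Cmult half (Cplus
             (Cplus (Cmult c (Cexp_neg l (x, y))) (csum (dterm lam d (x, y)) (S N)))
             (Cmult kappa (Cplus (Cmult c (Cexp_neg l (x, y + h)))
                                 (csum (dterm lam d (x, y + h)) (S N)))))).
        { rewrite Cmod_mult, Hhalf.
          apply Rle_trans with (1 / 2 * (B + 1 * B)); [ | lra ].
          apply Rmult_le_compat_l; [ lra | ].
          eapply Rle_trans; [ apply Cmod_triangle | ].
          rewrite (Cmod_mult kappa), Hk. generalize (HB y) (HB (y + h)). lra. }
        rewrite (csum_ext (dterm lam d' (x, y)) (fun k => Cmult half (Cplus (dterm lam d (x, y) k)
                                           (Cmult kappa (dterm lam d (x, y + h) k))))).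
        2:{ intros k _. unfold dterm, d'. rewrite <- Cmult_assoc, Hshift. ring. }
        rewrite csum_scal, csum_plus, csum_scal.
        replace (Cmult c (Cexp_neg l (x, y))) with
          (Cmult c (Cmult (rho l) (Cexp_neg l (x, y)))) at 2 by (rewrite Hrl; ring).
        rewrite Hshift. ring.
Qed.

Definition abs_conv (lam : nat -> R) (a : nat -> C) (x : R) : Prop :=
  ex_series (fun n => Cmod (a n) * exp (- lam n * x)).

Lemma sum_f_R0_le_Series (u : nat -> R) N :
  (forall n, 0 <= u n) -> ex_series u -> sum_f_R0 u N <= Series u.
Proof.
  intros Hu He. apply (sum_incr u N (Series u)); [ | easy ].
  apply is_series_Reals, Series_correct, He.
Qed.

(** The index has the form [N + k] so that the approximating partial sum extends a prescribed
    one. *)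
Lemma dirichlet_rep_approx lam f a z N eta :
  dirichlet_rep lam f a -> 0 < eta ->
  exists k, Cmod (Cminus (f z) (csum (dterm lam a z) (S (N + k)))) <= eta.
Proof.
  intros Hf He. destruct (Hf z) as [H1 H2].
  destruct (H1 (eta / 2)) as [N1 HN1]; [ lra | ].
  destruct (H2 (eta / 2)) as [N2 HN2]; [ lra | ].
  exists (N1 + N2)%nat.
  specialize (HN1 (N + (N1 + N2))%nat). specialize (HN2 (N + (N1 + N2))%nat).
  rewrite <- dpartial_csum. eapply Rle_trans; [ apply Cmod_le_Re_Im | ].
  unfold Rdist in *.
  assert (HN1' := HN1 ltac:(lia)). assert (HN2' := HN2 ltac:(lia)).
  rewrite Rabs_minus_sym in HN1', HN2'.
  change (Re (Cminus ?p ?q)) with (Re p - Re q).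
  change (Im (Cminus ?p ?q)) with (Im p - Im q).
  unfold Cplx in *. lra.
Qed.

(** Pass through a later partial sum, within [eta] of [f z]. Its distance to the one at [N] is at
    most a block of the absolute series, hence at most the whole tail; then let [eta] tend to 0. The
    bound depends on [Re z] only, so it is uniform on vertical lines. *)
Lemma dirichlet_rep_tail lam f a z N :
  dirichlet_rep lam f a -> abs_conv lam a (Re z) ->
  Cmod (Cminus (f z) (csum (dterm lam a z) (S N)))
  <= Series (fun n => Cmod (a n) * exp (- lam n * Re z))
     - sum_f_R0 (fun n => Cmod (a n) * exp (- lam n * Re z)) N.
Proof.
  intros Hf Ha. apply le_epsilon. intros eta He.
  destruct (dirichlet_rep_approx lam f a z N eta Hf He) as [k Hk].
  replace (Cminus (f z) (csum (dterm lam a z) (S N))) with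
    (Cplus (Cminus (f z) (csum (dterm lam a z) (S (N + k))))
       (Cminus (csum (dterm lam a z) (S (N + k))) (csum (dterm lam a z) (S N)))) by ring.
  eapply Rle_trans; [ apply Cmod_triangle | ].
  generalize (Cmod_csum_sub_le (dterm lam a z) N k).
  rewrite !(sum_eq (fun n => Cmod (dterm lam a z n)) (fun n => Cmod (a n) * exp (- lam n * Re z)))
    by (intros; apply Cmod_dterm).
  generalize (sum_f_R0_le_Series (fun n => Cmod (a n) * exp (- lam n * Re z)) (N + k)
    (fun n => Rmult_le_pos _ _ (Cmod_ge_0 _) (Rlt_le _ _ (exp_pos _))) Ha).
  lra.
Qed.

Lemma Series_tail_small (u : nat -> R) n eps :
  ex_series u -> 0 < eps -> exists N, (n <= N)%nat /\ Series u - sum_f_R0 u N <= eps.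
Proof.
  intros Hu He.
  destruct (proj1 (is_series_Reals u (Series u)) (Series_correct u Hu) eps He) as [N HN].
  exists (n + N)%nat. split; [ lia | ].
  specialize (HN (n + N)%nat ltac:(lia)). unfold Rdist in HN.
  apply Rabs_def2 in HN. lra.
Qed.

(** Truncate where the absolute tail is at most [eps]. On the whole line the partial sum is then
    bounded by [B + eps], and the finite case applies. *)
Lemma coef_bound lam f a x B n :
  (forall m, m <> n -> lam m <> lam n) ->
  dirichlet_rep lam f a -> abs_conv lam a x ->
  (forall y, Cmod (f (x, y)) <= B) ->
  Cmod (a n) * exp (- lam n * x) <= B.
Proof.
  intros Hinj Hf Ha HB. apply le_epsilon. intros eps He.
  destruct (Series_tail_small _ n eps Ha He) as [N [HnN HN]].
  (* The term of index [n] is taken out, to play the role of the isolated exponential in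
     [coef_bound_finite]. *)
  set (d := fun j => if Nat.eq_dec j n then RtoC 0 else a j).
  apply (coef_bound_finite lam (lam n) x (B + eps) (a n) (S N) d).
  - intros j Hj. unfold d. destruct (Nat.eq_dec j n); [ now left | right; auto ].
  - intros y.
    assert (E : Cplus (Cmult (a n) (Cexp_neg (lam n) (x, y))) (csum (dterm lam d (x, y)) (S N))
                = csum (dterm lam a (x, y)) (S N)).
    (* Generalising over the length [M] makes induction possible: the isolated term is present only
       once [M] exceeds [n]. *)
    { assert (G : forall M, csum (dterm lam a (x, y)) M =
         Cplus (if le_lt_dec M n then RtoC 0 else Cmult (a n) (Cexp_neg (lam n) (x, y)))
               (csum (dterm lam d (x, y)) M)).
      { induction M as [|M IH]; [ destruct (le_lt_dec 0 n); [ simpl; ring | lia ] | ].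
        simpl csum. rewrite IH. unfold dterm at 2 4, d.
        destruct (Nat.eq_dec M n) as [->|]; destruct (le_lt_dec (S _) n);
          destruct (le_lt_dec _ n); try lia; ring. }
      rewrite (G (S N)). destruct (le_lt_dec (S N) n); [ lia | easy ]. }
    rewrite E.
    replace (csum (dterm lam a (x, y)) (S N)) with
      (Cminus (f (x, y)) (Cminus (f (x, y)) (csum (dterm lam a (x, y)) (S N)))) by ring.
    unfold Cminus at 1. eapply Rle_trans; [ apply Cmod_triangle | ]. rewrite Cmod_opp.
    generalize (dirichlet_rep_tail lam f a (x, y) N Hf Ha) (HB y).
    change (Re (x, y)) with x. lra.
Qed.

(** * Frequencies, convergence of the kernel series, and point evaluations *)

Lemma frequencies_incr lam m n : frequencies lam -> (m < n)%nat -> lam m < lam n.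
Proof.
  intros [_ [H _]]. induction 1; [ apply H | ].
  eapply Rlt_trans; [ eassumption | apply H ].
Qed.

Lemma frequencies_inj lam n : frequencies lam -> forall m, m <> n -> lam m <> lam n.
Proof.
  intros H m Hmn. destruct (Nat.lt_total m n) as [L|[L|L]]; [ | easy | ];
    generalize (frequencies_incr lam _ _ H L); lra.
Qed.

Lemma frequencies_pos lam n : frequencies lam -> (0 < n)%nat -> 0 < lam n.
Proof.
  intros H Hn. generalize (frequencies_incr lam _ _ H Hn). destruct H. lra.
Qed.

Lemma frequencies_nonneg lam n : frequencies lam -> 0 <= lam n.
Proof.
  intros H. destruct n as [|n]; [ apply H | ].
  left. apply frequencies_pos; [ easy | lia ].
Qed.

(** Comparison with a telescoping series. *)
Lemma ex_series_inv_sqr : ex_series (fun n => (/ INR (S n)) ^ 2).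
Proof.
  apply (@ex_series_le R_AbsRing R_CompleteNormedModule) with (fun n => 2 * (/ INR (S n) - / INR (S (S n)))).
  - intros n. change (norm ?x) with (Rabs x).
    assert (Hn := pos_INR n). rewrite !S_INR.
    assert (0 < / (INR n + 1)) by (apply Rinv_0_lt_compat; lra).
    rewrite Rabs_pos_eq by nra.
    apply Rminus_le.
    replace (_ - _) with (- INR n * (/ (INR n + 1)) ^ 2 * / (INR n + 1 + 1)) by (field; lra).
    assert (0 < / (INR n + 1 + 1)) by (apply Rinv_0_lt_compat; lra).
    assert (0 <= INR n * (/ (INR n + 1)) ^ 2) by (apply Rmult_le_pos; [ lra | apply pow2_ge_0 ]).
    nra.
  - apply (ex_series_scal_l 2 (fun n => / INR (S n) - / INR (S (S n)))). exists 1.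
    apply is_series_Reals. intros eps He.
    destruct (archimed_cor1 eps He) as [N [HN HN0]].
    exists N. intros n Hn.
    assert (E : sum_f_R0 (fun n => / INR (S n) - / INR (S (S n))) n = 1 - / INR (S (S n))).
    { clear. induction n as [|n IH]; [ simpl; field | rewrite tech5, IH; ring ]. }
    rewrite E. unfold Rdist.
    assert (0 < / INR (S (S n))) by (apply Rinv_0_lt_compat, lt_0_INR; lia).
    rewrite Rabs_left by lra.
    assert (/ INR (S (S n)) <= / INR N); [ | lra ].
    apply Rinv_le_contravar; [ apply lt_0_INR; lia | apply le_INR; lia ].
Qed.

(* The squared norm of the reproducing kernel at a point of real part x is the sum of these. *)
Definition kterm (lam beta : nat -> R) (x : R) (n : nat) : R :=
  (exp (- lam n * x) / beta n) ^ 2.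

(** For large [n], the growth condition on [lam] gives [INR (S n) <= exp (M * lam n)], while (E)
    makes [beta n] at least [exp ((Rmax M 0 - x) * lam n)]. The quotient in [kterm] is therefore at
    most [/ INR (S n)], and its square is summable. *)
Lemma ex_series_kterm lam beta x :
  frequencies lam -> condE lam beta -> ex_series (kterm lam beta x).
Proof.
  intros Hl [Hb HE].
  destruct (Hl) as [_ [_ [_ [M [N0 HM]]]]].
  destruct (HE (Rmax M 0 - x)) as [N1 HN1].
  (* The successor excludes index 0, so [lam n] is positive and the quotients by it can be
     cleared. *)
  apply (ex_series_incr_n _ (S (N0 + N1))).
  apply (@ex_series_le R_AbsRing R_CompleteNormedModule)
    with (fun k => (/ INR (S (S (N0 + N1) + k))) ^ 2).
  2:{ apply (ex_series_incr_n (fun n => (/ INR (S n)) ^ 2) (S (N0 + N1))), ex_series_inv_sqr. }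
  intros k. set (n := (S (N0 + N1) + k)%nat). change (norm ?u) with (Rabs u).
  assert (Hn : 0 < lam n) by (apply frequencies_pos; [ easy | unfold n; lia ]).
  specialize (HM n ltac:(unfold n; lia)). specialize (HN1 n ltac:(unfold n; lia)).
  specialize (Hb n).
  assert (HI : 0 < INR (S n)) by (apply lt_0_INR; lia).
  unfold kterm.
  assert (Hp : 0 < exp (- lam n * x) / beta n)
    by (apply Rdiv_lt_0_compat; [ apply exp_pos | easy ]).
  rewrite Rabs_pos_eq by (apply pow2_ge_0).
  apply pow_incr. split; [ lra | ].
  rewrite <- (exp_ln (beta n)) by easy. rewrite <- (exp_ln (INR (S n))) by easy.
  unfold Rdiv. rewrite <- !exp_Ropp, <- exp_plus.
  assert (H1 : ln (INR (S n)) <= M * lam n).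
  { replace (ln (INR (S n))) with (ln (INR (S n)) / lam n * lam n) by (field; lra).
    apply Rmult_le_compat_r; lra. }
  assert (H2 : (Rmax M 0 - x) * lam n <= ln (beta n)).
  { replace (ln (beta n)) with (ln (beta n) / lam n * lam n) by (field; lra).
    apply Rmult_le_compat_r; lra. }
  assert (H3 := Rmax_l M 0).
  apply exp_le. nra.
Qed.

Lemma kterm_nonneg lam beta x n : 0 <= kterm lam beta x n.
Proof. apply pow2_ge_0. Qed.

Lemma coef_normsq_is_series beta a s :
  coef_normsq beta a s -> is_series (fun n => (Cmod (a n) * beta n) ^ 2) s.
Proof.
  intros H. apply is_series_Reals in H. eapply is_series_ext; [ | exact H ].
  intros n. simpl. rewrite Cnorm2_Cmod. ring.
Qed.

(** Each term is a product of [p = Cmod (a n) * beta n] and [q = exp (- lam n * x) / beta n], and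
    [p * q <= p ^ 2 + q ^ 2] with both squares summable. *)
Lemma coef_normsq_abs_conv lam beta a s x :
  frequencies lam -> condE lam beta -> coef_normsq beta a s -> abs_conv lam a x.
Proof.
  intros Hl HE Ha.
  apply (@ex_series_le R_AbsRing R_CompleteNormedModule)
    with (fun n => (Cmod (a n) * beta n) ^ 2 + kterm lam beta x n).
  - intros n. change (norm ?u) with (Rabs u).
    rewrite Rabs_pos_eq by (apply Rmult_le_pos; [ apply Cmod_ge_0 | left; apply exp_pos ]).
    unfold kterm. destruct HE as [Hb _]. specialize (Hb n).
    replace (Cmod (a n) * exp (- lam n * x))
      with ((Cmod (a n) * beta n) * (exp (- lam n * x) / beta n)) by (field; lra).
    set (p := _ * beta n). set (q := _ / _).
    generalize (pow2_ge_0 (p - q)) (pow2_ge_0 p) (pow2_ge_0 q). nra.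
  - apply (@ex_series_plus R_AbsRing R_NormedModule).
    + exists s. apply coef_normsq_is_series, Ha.
    + apply ex_series_kterm; easy.
Qed.

Lemma Cauchy_Schwarz_sum (u v : nat -> R) N :
  sum_f_R0 (fun n => u n * v n) N ^ 2
  <= sum_f_R0 (fun n => u n ^ 2) N * sum_f_R0 (fun n => v n ^ 2) N.
Proof.
  induction N as [|N IH]; [ simpl; nra | ].
  rewrite !tech5.
  assert (HU : 0 <= sum_f_R0 (fun n => u n ^ 2) N) by (apply cond_pos_sum; intros; apply pow2_ge_0).
  assert (HV : 0 <= sum_f_R0 (fun n => v n ^ 2) N) by (apply cond_pos_sum; intros; apply pow2_ge_0).
  set (P := sum_f_R0 (fun n => u n * v n) N) in *.
  set (U := sum_f_R0 (fun n => u n ^ 2) N) in *.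
  set (V := sum_f_R0 (fun n => v n ^ 2) N) in *.
  set (p := u (S N)). set (q := v (S N)).
  (* The cross term of the induction step: after squaring, [P ^ 2 <= U * V] reduces it to the
     arithmetic-geometric inequality for [U * q ^ 2] and [p ^ 2 * V]. *)
  assert (H : 2 * P * (p * q) <= U * q ^ 2 + p ^ 2 * V).
  { apply Rsqr_incr_0_var.
    - assert (H1 : 0 <= (p * q) ^ 2) by (apply pow2_ge_0).
      assert (H2 : P ^ 2 * (p * q) ^ 2 <= U * V * (p * q) ^ 2) by (apply Rmult_le_compat_r; easy).
      generalize (pow2_ge_0 (U * q ^ 2 - p ^ 2 * V)). unfold Rsqr. nra.
    - generalize (pow2_ge_0 p) (pow2_ge_0 q). intros.
      apply Rplus_le_le_0_compat; apply Rmult_le_pos; easy. }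
  nra.
Qed.

(** Cauchy-Schwarz between the weighted coefficients [Cmod (a n) * beta n] and the kernel, on
    partial sums; this is the continuity of point evaluation. *)
Lemma eval_bound lam beta f a s z :
  frequencies lam -> condE lam beta ->
  dirichlet_rep lam f a -> coef_normsq beta a s ->
  Cmod (f z) <= sqrt s * sqrt (Series (kterm lam beta (Re z))).
Proof.
  intros Hl HE Hf Ha. apply le_epsilon. intros eta He.
  destruct (dirichlet_rep_approx lam f a z 0 eta Hf He) as [k Hk].
  replace (f z) with (Cplus (Cminus (f z) (csum (dterm lam a z) (S (0 + k))))
                         (csum (dterm lam a z) (S (0 + k)))) by ring.
  eapply Rle_trans; [ apply Cmod_triangle | ].
  rewrite Rplus_comm. apply Rplus_le_compat; [ | easy ].
  eapply Rle_trans; [ apply Cmod_csum_le | ]. simpl Nat.add.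
  apply coef_normsq_is_series in Ha.
  assert (Hs : sum_f_R0 (fun n => (Cmod (a n) * beta n) ^ 2) k <= s).
  { rewrite <- (is_series_unique _ _ Ha).
    apply sum_f_R0_le_Series; [ intros; apply pow2_ge_0 | now exists s ]. }
  assert (Hw : sum_f_R0 (kterm lam beta (Re z)) k <= Series (kterm lam beta (Re z))).
  { apply sum_f_R0_le_Series; [ apply kterm_nonneg | now apply ex_series_kterm ]. }
  assert (Hs0 : 0 <= sum_f_R0 (fun n => (Cmod (a n) * beta n) ^ 2) k)
    by (apply cond_pos_sum; intros; apply pow2_ge_0).
  assert (Hw0 : 0 <= sum_f_R0 (kterm lam beta (Re z)) k)
    by (apply cond_pos_sum; apply kterm_nonneg).
  rewrite (sum_eq _ (fun n => (Cmod (a n) * beta n) * (exp (- lam n * Re z) / beta n))).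
  2:{ intros n _. rewrite Cmod_dterm. field. generalize (proj1 HE n). lra. }
  rewrite <- sqrt_mult by lra.
  apply Rsqr_incr_0_var; [ | apply sqrt_pos ].
  rewrite Rsqr_sqrt by (apply Rmult_le_pos; lra).
  rewrite Rsqr_pow2. eapply Rle_trans; [ apply Cauchy_Schwarz_sum | ].
  apply Rmult_le_compat; easy.
Qed.

(** The difference of the two sequences represents the zero function, so [coef_bound] at abscissa 0
    with bound 0 kills every coefficient. *)
Lemma dirichlet_rep_unique lam beta f a s b t :
  frequencies lam -> condE lam beta ->
  dirichlet_rep lam f a -> coef_normsq beta a s ->
  dirichlet_rep lam f b -> coef_normsq beta b t ->
  forall n, a n = b n.
Proof.
  intros Hl HE Hfa Ha Hfb Hb n.
  set (c := fun n => Cminus (a n) (b n) : C).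
  assert (Hc : dirichlet_rep lam (fun _ => RtoC 0) c).
  { intros z.
    assert (E : forall N, dpartial lam c z N = Cminus (dpartial lam a z N) (dpartial lam b z N)).
    { intros N. rewrite !dpartial_csum.
      rewrite (csum_ext _ (fun n => Cplus (dterm lam a z n) (Cmult (Copp (RtoC 1)) (dterm lam b z n)))).
      2:{ intros k _. unfold dterm, c. ring. }
      rewrite csum_plus, csum_scal. Cring. }
    destruct (Hfa z) as [A1 A2]. destruct (Hfb z) as [B1 B2].
    split.
    - eapply Un_cv_ext; [ intros N; rewrite E; reflexivity | ].
      replace (Re (RtoC 0)) with (Re (f z) - Re (f z)) by (unfold Re; simpl; ring).
      exact (CV_minus _ _ _ _ A1 B1).
    - eapply Un_cv_ext; [ intros N; rewrite E; reflexivity | ].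
      replace (Im (RtoC 0)) with (Im (f z) - Im (f z)) by (unfold Im; simpl; ring).
      exact (CV_minus _ _ _ _ A2 B2). }
  assert (H : Cmod (c n) * exp (- lam n * 0) <= 0).
  { apply (coef_bound lam (fun _ => RtoC 0)); [ now apply frequencies_inj | easy | | ].
    - apply (@ex_series_le R_AbsRing R_CompleteNormedModule)
        with (fun n => Cmod (a n) * exp (- lam n * 0) + Cmod (b n) * exp (- lam n * 0)).
      + intros k. change (norm ?u) with (Rabs u).
        generalize (exp_pos (- lam k * 0)). intros Hp.
        rewrite Rabs_pos_eq by (apply Rmult_le_pos; [ apply Cmod_ge_0 | lra ]).
        rewrite <- Rmult_plus_distr_r. apply Rmult_le_compat_r; [ lra | ].
        unfold c, Cminus. eapply Rle_trans; [ apply Cmod_triangle | ]. rewrite Cmod_opp. lra.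
      + apply (@ex_series_plus R_AbsRing R_NormedModule); eapply coef_normsq_abs_conv; eassumption.
    - intros _. rewrite Cmod_0. lra. }
  rewrite Rmult_0_r, exp_0, Rmult_1_r in H.
  assert (H0 : c n = RtoC 0) by (apply Cmod_eq_0; generalize (Cmod_ge_0 (c n)); lra).
  replace (a n) with (Cplus (c n) (b n)) by (unfold c; ring).
  rewrite H0. Cring.
Qed.

(** * Dirichlet polynomials as test functions *)

(** With finite support all partial sums are eventually constant. Single exponentials and truncated
    kernels are obtained from this. *)
Lemma finite_dirichlet_rep lam beta a N :
  (forall n, (N < n)%nat -> a n = RtoC 0) ->
  dirichlet_rep lam (fun z => dpartial lam a z N) a /\
  coef_normsq beta a (sum_f_R0 (fun n => Cnorm2 (a n) * beta n ^ 2) N).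
Proof.
  intros Ha. split.
  - intros z.
    assert (E : forall n, (N <= n)%nat -> dpartial lam a z n = dpartial lam a z N).
    { induction 1 as [|n Hn IH]; [ easy | ].
      simpl. rewrite IH, (Ha (S n)) by lia.
      change (Cplus (dpartial lam a z N) (Cmult (RtoC 0) (Cexp_neg (lam (S n)) z))
              = dpartial lam a z N). ring. }
    split; intros eps He; exists N; intros n Hn; rewrite E by easy;
      unfold Rdist, Rminus; rewrite Rplus_opp_r, Rabs_R0; easy.
  - intros eps He. exists N. intros n Hn.
    assert (E : sum_f_R0 (fun n => Cnorm2 (a n) * beta n ^ 2) n
                = sum_f_R0 (fun n => Cnorm2 (a n) * beta n ^ 2) N).
    { induction Hn as [|n Hn IH]; [ easy | ].
      rewrite tech5, IH, (Ha (S n)) by lia. unfold Cnorm2, Re, Im; simpl. ring. }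
    rewrite E. unfold Rdist, Rminus; rewrite Rplus_opp_r, Rabs_R0; easy.
Qed.

Lemma dirichlet_rep_ext lam f g a :
  (forall z, f z = g z) -> dirichlet_rep lam f a -> dirichlet_rep lam g a.
Proof. intros E H z. rewrite <- E. apply H. Qed.

Definition single (k : nat) (c : C) (n : nat) : C :=
  if Nat.eq_dec n k then c else RtoC 0.

Lemma single_rep lam beta k c :
  dirichlet_rep lam (fun z => Cmult c (Cexp_neg (lam k) z)) (single k c) /\
  coef_normsq beta (single k c) (Cmod c ^ 2 * beta k ^ 2).
Proof.
  destruct (finite_dirichlet_rep lam beta (single k c) k) as [H1 H2].
  { intros n Hn. unfold single. destruct (Nat.eq_dec n k); [ lia | easy ]. }
  split.
  - refine (dirichlet_rep_ext _ _ _ _ _ H1). intros z. rewrite dpartial_csum.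
    simpl. unfold dterm at 2, single at 2. destruct (Nat.eq_dec k k); [ | lia ].
    replace (csum (dterm lam (single k c) z) k) with (RtoC 0); [ Cring | ].
    rewrite (csum_ext _ (fun _ => RtoC 0)).
    + symmetry. apply csum_0.
    + intros j Hj. unfold dterm, single. destruct (Nat.eq_dec j k); [ lia | ring ].
  - replace (Cmod c ^ 2 * beta k ^ 2)
      with (sum_f_R0 (fun n => Cnorm2 (single k c n) * beta n ^ 2) k); [ easy | ].
    destruct k as [|k].
    + simpl sum_f_R0. unfold single. simpl. rewrite Cnorm2_Cmod. ring.
    + rewrite tech5, <- Cnorm2_Cmod. unfold single at 2. destruct (Nat.eq_dec (S k) (S k)); [ | lia ].
      rewrite (sum_eq _ (fun _ => 0)).
      * rewrite sum_cte. ring.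
      * intros j Hj. unfold single. destruct (Nat.eq_dec j (S k)); [ lia | ].
        unfold Cnorm2, Re, Im; simpl. ring.
Qed.

(** * Kernel estimates and the growth of the symbol *)

(* Testing C_phi on the truncated reproducing kernel at phi w. *)
Lemma comp_bounded_kernel lam beta phi K w N :
  frequencies lam -> condE lam beta ->
  (forall f, inH lam beta f -> inH lam beta (fun z => f (phi z))) ->
  (forall f a s b t,
    dirichlet_rep lam f a -> coef_normsq beta a s ->
    dirichlet_rep lam (fun z => f (phi z)) b -> coef_normsq beta b t ->
    sqrt t <= K * sqrt s) ->
  sum_f_R0 (kterm lam beta (Re (phi w))) N <= K ^ 2 * Series (kterm lam beta (Re w)).
Proof.
  intros Hl HE Hst HK. set (u := phi w).
  (* Kernel coefficients: the conjugate of [Cexp_neg (lam n) u] is [Cexp_neg (lam n) (Cconj u)]. *)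
  set (a := fun n => if le_lt_dec n N
     then Cmult (Cexp_neg (lam n) (Cconj u)) (RtoC (/ beta n ^ 2)) else RtoC 0).
  set (SN := sum_f_R0 (kterm lam beta (Re u)) N).
  assert (Hb := proj1 HE).
  destruct (finite_dirichlet_rep lam beta a N) as [Hf Hs].
  { intros n Hn. unfold a. destruct (le_lt_dec n N); [ lia | easy ]. }
  assert (Es : sum_f_R0 (fun n => Cnorm2 (a n) * beta n ^ 2) N = SN).
  { apply sum_eq. intros n Hn. unfold a. destruct (le_lt_dec n N); [ | lia ].
    specialize (Hb n). rewrite Cnorm2_Cmod, Cmod_mult, Cmod_Cexp_neg, Cmod_R.
    rewrite Rabs_pos_eq by (left; apply Rinv_0_lt_compat, pow_lt, Hb).
    unfold kterm. change (Re (Cconj u)) with (Re u). field. lra. }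
  (* Reproducing property: the value of the truncated kernel at [u] equals its squared norm [SN]. *)
  assert (Eu : dpartial lam a u N = RtoC SN).
  { rewrite dpartial_csum. unfold SN. rewrite <- csum_RtoC. apply csum_ext.
    intros n Hn. unfold dterm, a. destruct (le_lt_dec n N); [ | lia ].
    specialize (Hb n).
    replace (Cmult (Cmult (Cexp_neg (lam n) (Cconj u)) (RtoC (/ beta n ^ 2))) (Cexp_neg (lam n) u))
      with (Cmult (Cexp_neg (lam n) (Cplus (Cconj u) u)) (RtoC (/ beta n ^ 2)))
      by (rewrite Cexp_neg_add; ring).
    unfold Cexp_neg, Cplus, Cconj, Cmult, kterm, RtoC, Re, Im. simpl fst. simpl snd.
    rewrite Rplus_opp_l, Rmult_0_r, cos_0, sin_0, Rmult_plus_distr_l, exp_plus.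
    f_equal; field; lra. }
  rewrite Es in Hs.
  destruct (Hst _ (ex_intro _ a (ex_intro _ SN (conj Hf Hs)))) as [b [t [Hfb Ht]]].
  specialize (HK _ _ _ _ _ Hf Hs Hfb Ht).
  assert (Hw := eval_bound lam beta _ b t w Hl HE Hfb Ht). cbv beta in Hw.
  fold u in Hw. rewrite Eu, Cmod_R in Hw.
  assert (HS : 0 <= SN) by (apply cond_pos_sum, kterm_nonneg).
  rewrite Rabs_pos_eq in Hw by easy.
  set (W := Series (kterm lam beta (Re w))) in *.
  assert (HW : 0 <= W).
  { eapply Rle_trans; [ apply (kterm_nonneg lam beta (Re w) 0) | ].
    apply (sum_f_R0_le_Series (kterm lam beta (Re w)) 0 (kterm_nonneg _ _ _)).
    now apply ex_series_kterm. }
  (* The estimates so far combine to [SN <= K * sqrt SN * sqrt W]. Dividing by [sqrt SN] needs [SN]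
     positive; the other case is trivial. *)
  destruct HS as [HS|HS].
  - assert (Hq := sqrt_lt_R0 _ HS). assert (HqW := sqrt_pos W).
    assert (H : sqrt SN <= K * sqrt W).
    { apply Rmult_le_reg_r with (sqrt SN); [ easy | ].
      rewrite sqrt_sqrt by lra.
      eapply Rle_trans; [ apply Hw | ].
      replace (K * sqrt W * sqrt SN) with (K * sqrt SN * sqrt W) by ring.
      apply Rmult_le_compat_r; easy. }
    rewrite <- (sqrt_sqrt SN), <- (sqrt_sqrt W) by lra. nra.
  - rewrite <- HS. apply Rmult_le_pos; [ apply pow2_ge_0 | easy ].
Qed.

(** A move to the left by at least [D] multiplies the term of index [n >= 1] by at least
    [exp (2 * lam n * D)], hence by the factor for [lam 1]. The term of index 0 is left out because
    a zero frequency does not grow. *)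
Lemma kterm_shift_sum lam beta x x' D N :
  frequencies lam -> 0 <= D -> x' <= x - D ->
  exp (2 * lam 1%nat * D) * (sum_f_R0 (kterm lam beta x) N - kterm lam beta x 0)
  <= sum_f_R0 (kterm lam beta x') N.
Proof.
  intros Hl HD Hx. induction N as [|N IH].
  - simpl. rewrite Rminus_diag, Rmult_0_r. apply kterm_nonneg.
  - rewrite !tech5.
    enough (exp (2 * lam 1%nat * D) * kterm lam beta x (S N) <= kterm lam beta x' (S N)) by lra.
    unfold kterm, Rdiv. rewrite !Rpow_mult_distr, <- Rmult_assoc.
    apply Rmult_le_compat_r; [ apply pow2_ge_0 | ].
    simpl. rewrite !Rmult_1_r, <- !exp_plus. apply exp_le.
    assert (lam 1%nat <= lam (S N)).
    { destruct N; [ lra | ]. left. apply frequencies_incr; [ easy | lia ]. }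
    assert (0 < lam 1%nat) by (apply frequencies_pos; [ easy | lia ]).
    nra.
Qed.

(** If [Re (phi w)] were below [Re w - D], the shift and kernel estimates would give [W <= 2 * k0],
    where [k0] is the constant kernel term at index 0. Far to the left the next term alone is at
    least [4 * k0], a contradiction. *)
Lemma comp_bounded_growth lam beta phi :
  frequencies lam -> lam 0%nat = 0 -> condE lam beta -> comp_bounded lam beta phi ->
  exists r D, forall w, Re w <= r -> Re w - D <= Re (phi w).
Proof.
  intros Hl H0 HE [Hst [K HK]].
  set (l := lam 1%nat).
  assert (Hl1 : 0 < l) by (apply frequencies_pos; [ easy | lia ]).
  assert (Hb0 := proj1 HE 0%nat). assert (Hb1 := proj1 HE 1%nat).
  (* Once [exp (- l * Re w) >= q], the kernel term of index 1 is at least four times that of index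
     0. *)
  set (q := 2 * beta 1%nat / beta 0%nat).
  assert (Hq : 0 < q) by (apply Rdiv_lt_0_compat; lra).
  assert (HK2 : 0 <= K ^ 2) by apply pow2_ge_0.
  (* Chosen so that [exp (2 * l * D) = 2 * K ^ 2 + 1]; the summand 1 keeps [D] nonnegative for every
     [K], and [K ^ 2 / (2 * K ^ 2 + 1)] stays below 1/2. *)
  set (D := ln (2 * K ^ 2 + 1) / (2 * l)).
  assert (HD : exp (2 * l * D) = 2 * K ^ 2 + 1).
  { unfold D. replace (2 * l * (_ / _)) with (ln (2 * K ^ 2 + 1)) by (field; lra).
    apply exp_ln. lra. }
  assert (HD0 : 0 <= D).
  { apply Rmult_le_pos; [ | left; apply Rinv_0_lt_compat; lra ].
    rewrite <- ln_1. apply ln_le; lra. }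
  exists (- ln q / l), D. intros w Hw. apply Rnot_lt_le. intros Hc.
  set (W := Series (kterm lam beta (Re w))).
  assert (Hex := ex_series_kterm lam beta (Re w) Hl HE).
  assert (Hk0 : kterm lam beta (Re w) 0 = (/ beta 0%nat) ^ 2).
  { unfold kterm. rewrite H0, Ropp_0, Rmult_0_l, exp_0. unfold Rdiv. now rewrite Rmult_1_l. }
  assert (Hk1 : (2 * / beta 0%nat) ^ 2 <= kterm lam beta (Re w) 1).
  { unfold kterm. apply pow_incr.
    assert (Hi := Rinv_0_lt_compat _ Hb0). split; [ lra | ].
    apply Rmult_le_reg_r with (beta 1%nat); [ easy | ].
    replace (2 * / beta 0%nat * beta 1%nat) with q by (unfold q; field; lra).
    replace (exp (- lam 1%nat * Re w) / beta 1%nat * beta 1%nat)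
      with (exp (- lam 1%nat * Re w)) by (field; lra).
    rewrite <- (exp_ln q) by easy. apply exp_le. fold l.
    replace (ln q) with (- l * (- ln q / l)) by (field; lra). nra. }
  assert (HW1 : kterm lam beta (Re w) 0 + kterm lam beta (Re w) 1 <= W).
  { exact (sum_f_R0_le_Series (kterm lam beta (Re w)) 1 (kterm_nonneg _ _ _) Hex). }
  assert (Hi : 0 < (/ beta 0%nat) ^ 2) by (apply pow_lt, Rinv_0_lt_compat, Hb0).
  assert (HW2 : W <= kterm lam beta (Re w) 0 + W / 2).
  { apply le_epsilon. intros eps He.
    destruct (Series_tail_small _ 0 eps Hex He) as [N [_ HN]]. fold W in HN.
    assert (H1 := kterm_shift_sum lam beta (Re w) (Re (phi w)) D N Hl HD0 ltac:(lra)).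
    assert (H2 := comp_bounded_kernel lam beta phi K w N Hl HE Hst HK).
    fold W in H2. fold l in H1. rewrite HD in H1.
    set (SN := sum_f_R0 (kterm lam beta (Re w)) N) in *.
    enough (SN - kterm lam beta (Re w) 0 <= W / 2) by lra.
    apply Rmult_le_reg_l with (2 * K ^ 2 + 1); [ lra | ]. nra. }
  rewrite Hk0 in HW1, HW2. rewrite Rpow_mult_distr in Hk1. lra.
Qed.

(** * Continuity, and lifting through the exponential *)

Definition Ccontinuous (psi : C -> C) : Prop :=
  forall z eps, 0 < eps -> exists delta, 0 < delta /\
    forall h, Cmod h < delta -> Cmod (Cminus (psi (Cplus z h)) (psi z)) < eps.

Lemma entire_continuous phi : entire phi -> Ccontinuous phi.
Proof.
  intros H z eps He. destruct (H z) as [l Hl].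
  destruct (Hl 1 Rlt_0_1) as [d [Hd Hh]].
  assert (Hm := Cmod_ge_0 l).
  assert (Hp : 0 < eps / (2 + Cmod l)) by (apply Rdiv_lt_0_compat; lra).
  exists (Rmin d (eps / (2 + Cmod l))). split; [ now apply Rmin_glb_lt | ].
  intros h Hlt.
  assert (H1 : Cmod h < d) by (eapply Rlt_le_trans; [ exact Hlt | apply Rmin_l ]).
  assert (H2 : Cmod h < eps / (2 + Cmod l)) by (eapply Rlt_le_trans; [ exact Hlt | apply Rmin_r ]).
  specialize (Hh h). rewrite !Cnorm_Cmod in Hh. specialize (Hh H1).
  change (Cmod (Cminus (Cminus (phi (Cplus z h)) (phi z)) (Cmult l h)) <= 1 * Cmod h) in Hh.
  replace (Cminus (phi (Cplus z h)) (phi z)) with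
    (Cplus (Cminus (Cminus (phi (Cplus z h)) (phi z)) (Cmult l h)) (Cmult l h)) by ring.
  eapply Rle_lt_trans; [ apply Cmod_triangle | ]. rewrite (Cmod_mult l).
  assert (H3 : Cmod h * (2 + Cmod l) < eps).
  { replace eps with (eps / (2 + Cmod l) * (2 + Cmod l)) by (field; lra).
    apply Rmult_lt_compat_r; lra. }
  generalize (Cmod_ge_0 h). nra.
Qed.

Lemma cos_lt_1 t : 0 < t <= PI -> cos t < 1.
Proof.
  intros [H1 H2]. rewrite <- cos_0. apply cos_decreasing_1; lra.
Qed.

(** Moduli give the real parts. Congruence of [mu * Im a] and [mu * Im b] modulo 2 pi is recorded as
    a cosine equal to 1, which avoids integers. *)
Lemma Cexp_neg_eq mu a b :
  0 < mu -> Cexp_neg mu a = Cexp_neg mu b ->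
  Re a = Re b /\ cos (mu * (Im b - Im a)) = 1.
Proof.
  intros Hmu E.
  assert (HR : Re a = Re b).
  { assert (H : exp (- mu * Re a) = exp (- mu * Re b)) by (rewrite <- !Cmod_Cexp_neg, E; easy).
    apply exp_inv in H. nra. }
  split; [ easy | ].
  unfold Cexp_neg in E. rewrite HR in E.
  assert (Hp := exp_pos (- mu * Re b)). injection E as E1 E2.
  apply Rmult_eq_reg_l in E1; [ | lra ].
  assert (E3 : sin (mu * Im a) = sin (mu * Im b)).
  { apply Rmult_eq_reg_l with (exp (- mu * Re b)); lra. }
  rewrite Rmult_minus_distr_l, cos_minus, E1, E3.
  rewrite Rplus_comm. exact (sin2_cos2 (mu * Im b)).
Qed.

(* Im psi moves continuously inside a coset of the discrete group (2 pi / mu) Z. *)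
Lemma Cexp_neg_const_lift psi mu :
  0 < mu -> Ccontinuous psi ->
  (forall z w, Cexp_neg mu (psi z) = Cexp_neg mu (psi w)) ->
  forall z w, psi z = psi w.
Proof.
  intros Hmu Hc HE.
  assert (key : forall z w, Im (psi w) <= Im (psi z)).
  { intros z w. apply Rnot_lt_le. intros Hlt.
    set (path := fun t : R => Cplus z (Cmult (RtoC t) (Cminus w z))).
    set (u := fun t => Im (psi (path t))).
    assert (Hu : Ranalysis1.continuity u).
    { intros t eps He. destruct (Hc (path t) eps He) as [d [Hd Hh]].
      assert (Hm := Cmod_ge_0 (Cminus w z)).
      exists (d / (1 + Cmod (Cminus w z))). split; [ apply Rdiv_lt_0_compat; lra | ].
      intros t' [_ Ht']. simpl in *. unfold R_dist in *.
      assert (E : path t' = Cplus (path t) (Cmult (RtoC (t' - t)) (Cminus w z))).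
      { unfold path. rewrite RtoC_minus. ring. }
      unfold u. rewrite E. eapply Rle_lt_trans; [ | apply Hh ].
      - apply (Im_le_Cmod (Cminus (psi (Cplus (path t) (Cmult (RtoC (t' - t)) (Cminus w z)))) (psi (path t)))).
      - rewrite Cmod_mult, Cmod_R.
        replace d with (d / (1 + Cmod (Cminus w z)) * (1 + Cmod (Cminus w z))) by (field; lra).
        generalize (Rabs_pos (t' - t)). nra. }
    assert (u0 : u 0 = Im (psi z)) by (unfold u, path; do 2 f_equal; ring).
    assert (u1 : u 1 = Im (psi w)) by (unfold u, path; do 2 f_equal; ring).
    (* By the intermediate value theorem the imaginary part rises by exactly [m] somewhere on the
       segment. The cap [PI / mu] puts [mu * m] in the interval (0, PI], where the cosine is below
       1. *)
    set (m := Rmin (Im (psi w) - Im (psi z)) (PI / mu)).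
    assert (Hpi : 0 < PI / mu) by (apply Rdiv_lt_0_compat; [ apply PI_RGT_0 | easy ]).
    assert (Hm : 0 < m) by (apply Rmin_glb_lt; lra).
    assert (Hm1 : m <= Im (psi w) - Im (psi z)) by apply Rmin_l.
    assert (Hm2 : m <= PI / mu) by apply Rmin_r.
    destruct (IVT_gen u 0 1 (Im (psi z) + m) Hu) as [t [_ Ht]].
    { rewrite u0, u1, Rmin_left, Rmax_right by lra. lra. }
    destruct (Cexp_neg_eq mu (psi z) (psi (path t)) Hmu (HE _ _)) as [_ Hcos].
    fold (u t) in Hcos. rewrite Ht in Hcos.
    replace (Im (psi z) + m - Im (psi z)) with m in Hcos by ring.
    assert (cos (mu * m) < 1); [ | lra ].
    apply cos_lt_1. split; [ nra | ].
    replace PI with (mu * (PI / mu)) by (field; lra). nra. }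
  intros z w.
  assert (HR := proj1 (Cexp_neg_eq mu _ _ Hmu (HE z w))).
  assert (HI : Im (psi z) = Im (psi w)) by (apply Rle_antisym; apply key).
  destruct (psi z), (psi w). unfold Re, Im in *; simpl in *. congruence.
Qed.

Lemma Cexp_neg_surj mu (c : C) : 0 < mu -> c <> RtoC 0 -> exists z, Cexp_neg mu z = c.
Proof.
  intros Hmu Hc. assert (Hr : 0 < Cmod c) by now apply Cmod_gt_0.
  set (r := Cmod c) in *. set (p := fst c / r). set (q := snd c / r).
  assert (Hrr : r ^ 2 = fst c ^ 2 + snd c ^ 2).
  { unfold r, Cmod. apply pow2_sqrt. generalize (pow2_ge_0 (fst c)) (pow2_ge_0 (snd c)). lra. }
  assert (Hpq : p ^ 2 + q ^ 2 = 1).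
  { unfold p, q. replace (_ + _) with ((fst c ^ 2 + snd c ^ 2) / r ^ 2) by (field; lra).
    rewrite <- Hrr. field. lra. }
  assert (Hp : -1 <= p <= 1) by nra.
  assert (Hsin : sin (acos p) = Rabs q).
  { rewrite sin_acos by easy. rewrite <- sqrt_Rsqr_abs. f_equal. unfold Rsqr. lra. }
  (* [acos p] only reaches angles with nonnegative sine, so the sign of [q] decides between [acos p]
     and its opposite. *)
  assert (Hth : exists th, cos th = p /\ - sin th = q).
  { destruct (Rle_lt_dec q 0).
    - exists (acos p). rewrite cos_acos, Hsin, Rabs_left1 by easy. lra.
    - exists (- acos p). rewrite cos_neg, sin_neg, cos_acos, Hsin, Rabs_pos_eq by lra. lra. }
  destruct Hth as [th [H1 H2]].
  exists (- ln r / mu, th / mu). unfold Cexp_neg, Re, Im; simpl.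
  replace (- mu * (- ln r / mu)) with (ln r) by (field; lra).
  replace (mu * (th / mu)) with th by (field; lra).
  rewrite exp_ln, H1 by easy. replace (- (r * sin th)) with (r * q) by (rewrite <- H2; ring).
  unfold p, q. destruct c; simpl. f_equal; field; lra.
Qed.

Lemma dominated_exp_eq_0 (m A k r : R) :
  0 <= m -> 0 < A -> 0 < k -> (forall x, x <= r -> m <= A * exp (k * x)) -> m = 0.
Proof.
  intros Hm HA Hk H. apply Rle_antisym; [ | easy ]. apply Rnot_lt_le. intros Hp.
  (* Far enough to the left that [A * exp (k * x)] is at most [m / 2]. *)
  set (x := Rmin r (ln (m / (2 * A)) / k)).
  specialize (H x (Rmin_l _ _)).
  assert (Hx : k * x <= ln (m / (2 * A))).
  { replace (ln (m / (2 * A))) with (k * (ln (m / (2 * A)) / k)) by (field; lra).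
    apply Rmult_le_compat_l; [ lra | apply Rmin_r ]. }
  apply exp_le in Hx. rewrite exp_ln in Hx by (apply Rdiv_lt_0_compat; lra).
  assert (A * exp (k * x) <= A * (m / (2 * A))) by (apply Rmult_le_compat_l; lra).
  replace (A * (m / (2 * A))) with (m / 2) in * by (field; lra). lra.
Qed.

(* By the growth estimate, e^{-lam_1 phi} is O(e^{-lam_1 Re z}) as Re z -> -oo, which
   kills all coefficients of frequency larger than lam_1. *)
Lemma comp_bounded_two_terms lam beta phi :
  frequencies lam -> lam 0%nat = 0 -> condE lam beta -> comp_bounded lam beta phi ->
  exists b0 b1 : C, forall z,
    Cexp_neg (lam 1%nat) (phi z) = Cplus b0 (Cmult b1 (Cexp_neg (lam 1%nat) z)).
Proof.
  intros Hl H0 HE HB.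
  destruct (comp_bounded_growth lam beta phi Hl H0 HE HB) as [r [D HrD]].
  destruct (single_rep lam beta 1 (RtoC 1)) as [Hf Hs].
  destruct (proj1 HB _ (ex_intro _ _ (ex_intro _ _ (conj Hf Hs)))) as [b [t [Hb Ht]]].
  set (l := lam 1%nat) in *.
  assert (Hl1 : 0 < l) by (apply frequencies_pos; [ easy | lia ]).
  assert (Hbn : forall n, (1 < n)%nat -> b n = RtoC 0).
  { intros n Hn. apply Cmod_eq_0.
    assert (Hln : l < lam n) by (apply frequencies_incr; easy).
    (* The constant [exp (l * D)] and the rate [lam n - l] come from dividing the bound
       [exp (- l * (x - D))] on the line of abscissa [x] by [exp (- lam n * x)]. *)
    apply (dominated_exp_eq_0 _ (exp (l * D)) (lam n - l) r);
      [ apply Cmod_ge_0 | apply exp_pos | lra | ].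
    intros x Hx.
    assert (H := coef_bound lam _ b x (exp (- l * (x - D))) n (frequencies_inj lam n Hl) Hb
                   (coef_normsq_abs_conv lam beta b t x Hl HE Ht)).
    cbv beta in H.
    assert (H' : Cmod (b n) * exp (- lam n * x) <= exp (- l * (x - D))).
    { apply H. intros y. rewrite Cmult_1_l, Cmod_Cexp_neg. apply exp_le.
      assert (G := HrD (x, y) Hx). change (Re (x, y)) with x in G. nra. }
    apply Rmult_le_reg_r with (exp (- lam n * x)); [ apply exp_pos | ].
    eapply Rle_trans; [ exact H' | ]. rewrite <- !exp_plus. apply exp_le. lra. }
  destruct (finite_dirichlet_rep lam beta b 1 Hbn) as [Hb' _].
  exists (b 0%nat), (b 1%nat). intros z.
  assert (E : Cmult (RtoC 1) (Cexp_neg l (phi z)) = dpartial lam b z 1).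
  { destruct (Hb z) as [P1 P2]. destruct (Hb' z) as [Q1 Q2].
    assert (E1 := UL_sequence _ _ _ P1 Q1). assert (E2 := UL_sequence _ _ _ P2 Q2).
    unfold Re, Im in E1, E2. apply injective_projections; assumption. }
  rewrite Cmult_1_l in E. rewrite E, dpartial_csum. simpl. unfold dterm.
  rewrite H0, Cexp_neg_freq_0. fold l. Cring.
Qed.

(** * Norm estimates for translations and constants *)

(** Translating by [b] multiplies the coefficient of index [n] by [Cexp_neg (lam n) b], whose
    modulus is at most 1 because [lam n] and [Re b] are nonnegative. *)
Lemma translation_rep lam beta phi b f a s :
  frequencies lam -> 0 <= Re b -> (forall z, phi z = Cadd z b) ->
  dirichlet_rep lam f a -> coef_normsq beta a s ->
  exists a' t, dirichlet_rep lam (fun z => f (phi z)) a' /\ coef_normsq beta a' t /\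
    0 <= t <= s.
Proof.
  intros Hl Hb Hphi Hf Hs.
  set (a' := fun n => Cmult (a n) (Cexp_neg (lam n) b) : Cplx).
  apply coef_normsq_is_series in Hs.
  assert (Hle : forall n, 0 <= (Cmod (a' n) * beta n) ^ 2 <= (Cmod (a n) * beta n) ^ 2).
  { intros n. split; [ apply pow2_ge_0 | ].
    unfold a'. rewrite Cmod_mult, Cmod_Cexp_neg, !Rpow_mult_distr.
    assert (He : exp (- lam n * Re b) <= 1).
    { rewrite <- exp_0. apply exp_le. generalize (frequencies_nonneg lam n Hl). nra. }
    assert (He2 : exp (- lam n * Re b) ^ 2 <= 1 ^ 2).
    { apply pow_incr. split; [ left; apply exp_pos | easy ]. }
    apply Rmult_le_compat_r; [ apply pow2_ge_0 | ].
    rewrite <- (Rmult_1_r (Cmod (a n) ^ 2)) at 2.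
    apply Rmult_le_compat_l; [ apply pow2_ge_0 | lra ]. }
  assert (Hex : ex_series (fun n => (Cmod (a' n) * beta n) ^ 2)).
  { apply (@ex_series_le R_AbsRing R_CompleteNormedModule)
      with (fun n => (Cmod (a n) * beta n) ^ 2); [ | now exists s ].
    intros n. change (norm ?u) with (Rabs u). rewrite Rabs_pos_eq; apply Hle. }
  exists a', (Series (fun n => (Cmod (a' n) * beta n) ^ 2)). split; [ | split ].
  - intros z.
    assert (E : forall N, dpartial lam a' z N = dpartial lam a (phi z) N).
    { intros N. rewrite !dpartial_csum. apply csum_ext. intros n _.
      unfold dterm, a'. rewrite Hphi. change (Cadd z b) with (Cplus z b).
      rewrite Cexp_neg_add. Cring. }
    destruct (Hf (phi z)) as [H1 H2].
    split; [ eapply Un_cv_ext; [ | exact H1 ] | eapply Un_cv_ext; [ | exact H2 ] ];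
      intros N; now rewrite E.
  - apply is_series_Reals. eapply is_series_ext; [ | apply Series_correct, Hex ].
    intros n. simpl. rewrite Cnorm2_Cmod. ring.
  - split.
    + eapply Rle_trans; [ | apply (sum_f_R0_le_Series _ 0); [ apply Hle | exact Hex ] ].
      apply Hle.
    + rewrite <- (is_series_unique _ _ Hs). apply Series_le; [ exact Hle | now exists s ].
Qed.

Lemma coef_normsq_ext beta a b s t :
  (forall n, a n = b n) -> coef_normsq beta a s -> coef_normsq beta b t -> s = t.
Proof.
  intros E Ha Hb. apply coef_normsq_is_series in Ha, Hb.
  rewrite <- (is_series_unique _ _ Ha), <- (is_series_unique _ _ Hb).
  apply Series_ext. intros n. now rewrite E.
Qed.

(** Boundedness speaks of every representation of the composite; uniqueness of coefficients
    identifies it with the one built in [translation_rep]. *)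
Lemma translation_norm_le lam beta phi f a s b t :
  frequencies lam -> condE lam beta -> is_translation phi ->
  dirichlet_rep lam f a -> coef_normsq beta a s ->
  dirichlet_rep lam (fun z => f (phi z)) b -> coef_normsq beta b t ->
  sqrt t <= sqrt s.
Proof.
  intros Hl HE [c [Hc Hphi]] Hf Ha Hfb Hb.
  destruct (translation_rep lam beta phi c f a s Hl Hc Hphi Hf Ha) as [a' [t' [Hf' [Ha' Ht']]]].
  rewrite (coef_normsq_ext beta b a' t t'
    (dirichlet_rep_unique lam beta _ b t a' t' Hl HE Hfb Hb Hf' Ha') Hb Ha').
  now apply sqrt_le_1_alt.
Qed.

Lemma constant_rep lam beta f c :
  lam 0%nat = 0 -> (forall z, f z = c) ->
  dirichlet_rep lam f (single 0 c) /\ coef_normsq beta (single 0 c) (Cmod c ^ 2 * beta 0%nat ^ 2).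
Proof.
  intros H0 Hf. destruct (single_rep lam beta 0 c) as [H1 H2]. split; [ | easy ].
  refine (dirichlet_rep_ext _ _ _ _ _ H1). intros z.
  rewrite H0, Cexp_neg_freq_0, Hf. apply Cmult_1_r.
Qed.

(** The composite is the constant [f c], of norm [Cmod (f c) * beta 0], and [eval_bound] controls
    [f c]. *)
Lemma constant_norm_le lam beta phi c f a s b t :
  frequencies lam -> lam 0%nat = 0 -> condE lam beta -> (forall z, phi z = c) ->
  dirichlet_rep lam f a -> coef_normsq beta a s ->
  dirichlet_rep lam (fun z => f (phi z)) b -> coef_normsq beta b t ->
  sqrt t <= beta 0%nat * sqrt (Series (kterm lam beta (Re c))) * sqrt s.
Proof.
  intros Hl H0 HE Hphi Hf Ha Hfb Hb.
  destruct (constant_rep lam beta (fun z => f (phi z)) (f c) H0) as [Hf' Ha'].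
  { intros z. now rewrite Hphi. }
  rewrite (coef_normsq_ext beta b _ t _
    (dirichlet_rep_unique lam beta _ b t _ _ Hl HE Hfb Hb Hf' Ha') Hb Ha').
  assert (Hb0 := proj1 HE 0%nat).
  rewrite <- Rpow_mult_distr, sqrt_pow2
    by (apply Rmult_le_pos; [ apply Cmod_ge_0 | lra ]).
  generalize (eval_bound lam beta f a s c Hl HE Hf Ha). nra.
Qed.

(** The constant function 1 lies in the space and is fixed by every composition operator. *)
Lemma comp_ratios_1 lam beta phi :
  lam 0%nat = 0 -> condE lam beta -> comp_ratios lam beta phi 1.
Proof.
  intros H0 HE. assert (Hb := proj1 HE 0%nat).
  set (s := Cmod (RtoC 1) ^ 2 * beta 0%nat ^ 2).
  assert (Hs : 0 < s).
  { unfold s. rewrite Cmod_1, pow1, Rmult_1_l. now apply pow_lt. }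
  exists (fun _ => RtoC 1), (single 0 (RtoC 1)), s, (single 0 (RtoC 1)), s.
  destruct (constant_rep lam beta (fun _ => RtoC 1) (RtoC 1) H0 (fun _ => eq_refl)) as [H1 H2].
  repeat (split; [ assumption | ]).
  symmetry. apply Rdiv_diag. generalize (sqrt_lt_R0 _ Hs). lra.
Qed.

Lemma comp_ratios_le lam beta phi K :
  (forall f a s b t,
    dirichlet_rep lam f a -> coef_normsq beta a s ->
    dirichlet_rep lam (fun z => f (phi z)) b -> coef_normsq beta b t ->
    sqrt t <= K * sqrt s) ->
  is_upper_bound (comp_ratios lam beta phi) K.
Proof.
  intros HK r [f [a [s [b [t [Hf [Ha [Hs [Hfb [Hb ->]]]]]]]]]].
  assert (Hq := sqrt_lt_R0 _ Hs).
  apply Rmult_le_reg_r with (sqrt s); [ easy | ].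
  replace (sqrt t / sqrt s * sqrt s) with (sqrt t) by (field; lra).
  exact (HK f a s b t Hf Ha Hfb Hb).
Qed.

(** Each [Cexp_neg (lam k)] is an eigenfunction with eigenvalue [Cexp_neg (lam k) b], so the moduli
    [exp (- lam k * Re b)] are all at most [K]. With [Re b] negative they would be unbounded. *)
Lemma comp_bounded_translation_Re lam beta phi b :
  frequencies lam -> condE lam beta -> comp_bounded lam beta phi ->
  (forall z, phi z = Cplus z b) -> 0 <= Re b.
Proof.
  intros Hl HE [_ [K HK]] Hphi. apply Rnot_lt_le. intros Hneg.
  assert (H : forall k, exp (- lam k * Re b) <= K).
  { intros k. assert (Hb := proj1 HE k).
    destruct (single_rep lam beta k (RtoC 1)) as [Hf Hs].
    destruct (single_rep lam beta k (Cexp_neg (lam k) b)) as [Hf' Hs'].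
    assert (Hf2 : dirichlet_rep lam (fun z => Cmult (RtoC 1) (Cexp_neg (lam k) (phi z)))
                    (single k (Cexp_neg (lam k) b))).
    { refine (dirichlet_rep_ext _ _ _ _ _ Hf'). intros z.
      rewrite Hphi, Cexp_neg_add. Cring. }
    assert (G := HK _ _ _ _ _ Hf Hs Hf2 Hs').
    rewrite Cmod_1, Cmod_Cexp_neg, <- !Rpow_mult_distr, !sqrt_pow2 in G
      by (try apply Rmult_le_pos; try (left; apply exp_pos); lra).
    apply Rmult_le_reg_r with (beta k); [ easy | lra ]. }
  assert (HK0 : 0 < K) by (eapply Rlt_le_trans; [ apply exp_pos | apply (H 0%nat) ]).
  destruct Hl as [_ [_ [Hinf _]]].
  destruct (Hinf (ln K / - Re b)) as [N HN]. specialize (HN N (le_n _)).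
  assert (ln K < - lam N * Re b).
  { replace (ln K) with (ln K / - Re b * - Re b) by (field; lra). nra. }
  specialize (H N). assert (G : exp (ln K) < exp (- lam N * Re b)) by now apply exp_increasing.
  rewrite exp_ln in G by easy. lra.
Qed.

(** * Determination of the symbol, and conclusion *)

Lemma comp_bounded_symbol lam beta phi :
  frequencies lam -> lam 0%nat = 0 -> condE lam beta -> entire phi ->
  comp_bounded lam beta phi -> is_constant phi \/ is_translation phi.
Proof.
  intros Hl H0 HE Hphi HB.
  destruct (comp_bounded_two_terms lam beta phi Hl H0 HE HB) as [b0 [b1 Hb]].
  set (l := lam 1%nat) in *.
  assert (Hl1 : 0 < l) by (apply frequencies_pos; [ easy | lia ]).
  assert (Hc := entire_continuous phi Hphi).
  destruct (Ceq_dec b1 (RtoC 0)) as [->|Hb1].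
  - left. exists (phi (RtoC 0)). intros z.
    apply (Cexp_neg_const_lift phi l Hl1 Hc). intros w w'.
    rewrite !Hb. Cring.
  - destruct (Ceq_dec b0 (RtoC 0)) as [->|Hb0].
    + right.
      (* Here [Cexp_neg l (psi z)] is the constant [b1], so the lifting lemma makes the displacement
         [psi] constant. *)
      set (psi := fun z => Cminus (phi z) z : C).
      assert (Hpsi : forall z w, psi z = psi w).
      { apply (Cexp_neg_const_lift psi l Hl1).
        - intros z eps He. destruct (Hc z (eps / 2)) as [d [Hd Hh]]; [ lra | ].
          exists (Rmin d (eps / 2)). split; [ apply Rmin_glb_lt; lra | ].
          intros h Hlt.
          assert (H1 : Cmod h < d) by (eapply Rlt_le_trans; [ exact Hlt | apply Rmin_l ]).
          assert (H2 : Cmod h < eps / 2) by (eapply Rlt_le_trans; [ exact Hlt | apply Rmin_r ]).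
          replace (Cminus (psi (Cplus z h)) (psi z)) with
            (Cplus (Cminus (phi (Cplus z h)) (phi z)) (Copp h)) by (unfold psi; ring).
          eapply Rle_lt_trans; [ apply Cmod_triangle | ]. rewrite Cmod_opp.
          specialize (Hh h H1). lra.
        - assert (E : forall z, Cexp_neg l (psi z) = b1).
          { intros z. assert (Hnz := Cexp_neg_nonzero l z).
            assert (G : Cmult (Cexp_neg l (psi z)) (Cexp_neg l z) = Cmult b1 (Cexp_neg l z)).
            { rewrite <- Cexp_neg_add. replace (Cplus (psi z) z) with (phi z) by (unfold psi; symmetry; Cring).
              rewrite Hb. Cring. }
            transitivity (Cdiv (Cmult (Cexp_neg l (psi z)) (Cexp_neg l z)) (Cexp_neg l z)).
            - symmetry.
              change (@eq C (Cdiv (Cmult (Cexp_neg l (psi z)) (Cexp_neg l z)) (Cexp_neg l z))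
                            (Cexp_neg l (psi z))).
              field. exact Hnz.
            - rewrite G. change (@eq C (Cdiv (Cmult b1 (Cexp_neg l z)) (Cexp_neg l z)) b1).
              field. exact Hnz. }
          intros z w. now rewrite !E. }
      assert (Htr : forall z, phi z = Cplus z (psi (RtoC 0))).
      { intros z. rewrite (Hpsi (RtoC 0) z). unfold psi. symmetry. Cring. }
      exists (psi (RtoC 0)). split; [ | exact Htr ].
      exact (comp_bounded_translation_Re lam beta phi _ Hl HE HB Htr).
    + exfalso.
      (* With both coefficients nonzero, a point where [Cexp_neg l z] equals [- b0 / b1] would be a
         zero of [Cexp_neg l (phi z)]. *)
      destruct (Cexp_neg_surj l (Copp (Cdiv b0 b1)) Hl1) as [z Hz].
      { intros E. apply Hb0.
        replace b0 with (Copp (Cmult (Copp (Cdiv b0 b1)) b1)) by (field; exact Hb1).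
        rewrite E. ring. }
      apply (Cexp_neg_nonzero l (phi z)). rewrite Hb, Hz.
      change (@eq C (Cplus b0 (Cmult b1 (Copp (Cdiv b0 b1)))) (RtoC 0)). field. exact Hb1.
Qed.

Theorem theorem4p7 (lam beta : nat -> R) (phi : Cplx -> Cplx)
  (Hlam : frequencies lam) (Hlam0 : lam 0%nat = 0) (HE : condE lam beta)
  (Hphi : entire phi) :
  (comp_bounded lam beta phi <-> (is_constant phi \/ is_translation phi)) /\
  (is_constant phi -> exists c : R, is_lub (comp_ratios lam beta phi) c /\ 1 <= c) /\
  (is_translation phi -> is_lub (comp_ratios lam beta phi) 1).
Proof.
  split; [ split | split ].
  - now apply comp_bounded_symbol.
  - intros [[c Hc]|Ht]; split.
    + intros f _.
      destruct (constant_rep lam beta (fun z => f (phi z)) (f c) Hlam0) as [H1 H2].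
      { intros z. now rewrite Hc. }
      do 2 eexists. split; eassumption.
    + exists (beta 0%nat * sqrt (Series (kterm lam beta (Re c)))).
      intros f a s b t. now apply constant_norm_le.
    + destruct Ht as [b [Hb Hz]]. intros f [a [s [Hf Hs]]].
      destruct (translation_rep lam beta phi b f a s Hlam Hb Hz Hf Hs)
        as [a' [t [H1 [H2 _]]]].
      now exists a', t.
    + exists 1. intros f a s b t Hf Ha Hfb Hb. rewrite Rmult_1_l.
      now apply (translation_norm_le lam beta phi f a s b t).
  - intros [c Hc].
    (* The norm exists as a supremum: the ratios are bounded by [constant_norm_le], and 1 is one of
       them. *)
    destruct (completeness (comp_ratios lam beta phi)) as [m Hm].
    + exists (beta 0%nat * sqrt (Series (kterm lam beta (Re c)))).
      apply comp_ratios_le. intros f a s b t. now apply constant_norm_le.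
    + exists 1. now apply comp_ratios_1.
    + exists m. split; [ exact Hm | ]. apply (proj1 Hm). now apply comp_ratios_1.
  - intros Ht. split.
    + apply comp_ratios_le. intros f a s b t Hf Ha Hfb Hb. rewrite Rmult_1_l.
      now apply (translation_norm_le lam beta phi f a s b t).
    (* The ratio 1 is attained, so no upper bound is smaller. *)
    + intros u Hu. apply Hu. now apply comp_ratios_1.
Qed.
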